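(* Let $\mathscr N:\mathbb R_+^{m\times n}\to\mathbb R_+$ be a monotone positively homogeneous function. Then for any $A\in\mathbb R_+^{m\times n}$ with $\mathscr N(A)>0$ we have $$\operatorname{rank}_+(A)\ \ge\ \tau_+(A)\ \ge\ \frac{\mathscr N^*(A)}{\mathscr N(A)}.$$
   Context: $\mathbb R_+^{m\times n}$ is the set of entrywise nonnegative real $m\times n$ matrices; $\le$ between matrices is entrywise. The nonnegative rank $\operatorname{rank}_+(A)$ is the smallest integer $r$ such that $A=\sum_{i=1}^r u_iv_i^T$ with entrywise nonnegative vectors $u_i\in\mathbb R^m$, $v_i\in\mathbb R^n$. Define $$\mathcal A_+(A)=\{R\in\mathbb R^{m\times n}: \operatorname{rank}R\le 1,\ 0\le R\le A\},$$ $$\tau_+(A)=\max\{L(A): L \text{ a linear functional on }\mathbb R^{m\times n},\ L(R)\le 1\ \ \forall R\in\mathcal A_+(A)\}.$$ A function $\mathscr N:\mathbb R_+^{m\times n}\to\mathbb R_+$ is positively homogeneous if $\mathscr N(\lambda A)=\lambda\mathscr N(A)$ for all $A\in\mathbb R_+^{m\times n}$ and $\lambda\ge 0$; it is monotone if $A\le B$ implies $\mathscr N(A)\le\mathscr N(B)$ for all $A,B\in\mathbb R_+^{m\times n}$. Set $$\mathcal A_{\mathscr N}=\{X\in\mathbb R_+^{m\times n}: \operatorname{rank}X\le 1,\ \mathscr N(X)\le 1\},\qquad \mathscr N^*(A)=\inf\{t>0: A\in t\,\operatorname{conv}(\mathcal A_{\mathscr N})\},$$ where $\operatorname{conv}$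 denotes the convex hull. *)

(* Defs.v *)
From HB Require Import structures.
From mathcomp Require Import all_boot all_order all_algebra.
From mathcomp Require Import all_classical all_reals all_analysis.
Set Implicit Arguments.
Unset Strict Implicit.
Unset Printing Implicit Defensive.
Import Order.TTheory GRing.Theory Num.Theory.
Import numFieldNormedType.Exports.
Local Open Scope classical_set_scope.
Local Open Scope ring_scope.

(* The set of entrywise nonnegative matrices is the library's
   [mxOver Num.nneg]; a function on it is represented by a function on all
   matrices of which only the values on [mxOver Num.nneg] are ever used. *)

Definition le_mx (R : numDomainType) m n (A B : 'M[R]_(m, n)) : Prop :=
  forall i j, A i j <= B i j.

Section NonnegativeRank.
Variable R : realType.

Definition nonneg_factorization m n (A : 'M[R]_(m, n)) (r : nat) : Prop :=
  exists u : 'I_r -> 'cV[R]_m, exists v : 'I_r -> 'cV[R]_n,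
    [/\ forall k, u k \is a mxOver Num.nneg,
        forall k, v k \is a mxOver Num.nneg
      & A = \sum_k u k *m (v k)^T].

Lemma nonneg_factorization_exists m n (A : 'M[R]_(m, n)) :
  A \is a mxOver Num.nneg -> exists r, `[< nonneg_factorization A r >].
Proof.
move=> /mxOverP A0; exists m; apply/asboolP.
exists (fun i => delta_mx i 0), (fun i => (row i A)^T); split.
- by move=> k; apply/mxOverP => i j; rewrite mxE nnegrE ler0n.
- by move=> k; apply/mxOverP => i j; rewrite !mxE.
- apply/matrixP => i j; rewrite summxE (bigD1 i) //= big1 ?addr0.
    by rewrite mxE big_ord1 !mxE !eqxx mul1r.
  by move=> k ki; rewrite mxE big_ord1 !mxE eq_sym (negbTE ki) mul0r.
Qed.

Definition nonneg_rank m n (A : 'M[R]_(m, n))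
    (A_ge0 : A \is a mxOver Num.nneg) : nat :=
  ex_minn (nonneg_factorization_exists A_ge0).

End NonnegativeRank.

Section TauPlus.
Variables (R : realType) (m n : nat).
Implicit Types (A X : 'M[R]_(m, n)).

Definition atoms_plus A : set 'M[R]_(m, n) :=
  [set X | [/\ (\rank X <= 1)%N, le_mx 0 X & le_mx X A]].

Definition tau_plus_values A : set R :=
  [set L A | L in [set L : {scalar 'M[R]_(m, n)} |
                     forall X, atoms_plus A X -> L X <= 1]].

(* The supremum is a maximum: see [tau_plus_max]. *)
Definition tau_plus A : R := sup (tau_plus_values A).

End TauPlus.

Definition convex_hull (R : numDomainType) (E : lmodType R) (S : set E) :
  set E := smallest (@convex_set R E) S.

Section AtomicGauge.
Variables (R : realType) (m n : nat) (N : 'M[R]_(m, n) -> R).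

Definition nonneg_valued : Prop :=
  forall A, A \is a mxOver Num.nneg -> 0 <= N A.

Definition positively_homogeneous : Prop :=
  forall (lambda : R) A, 0 <= lambda -> A \is a mxOver Num.nneg ->
    N (lambda *: A) = lambda * N A.

Definition monotone_mx : Prop :=
  forall A B, A \is a mxOver Num.nneg -> B \is a mxOver Num.nneg ->
    le_mx A B -> N A <= N B.

Definition atoms_of : set 'M[R]_(m, n) :=
  [set X | [/\ X \is a mxOver Num.nneg, (\rank X <= 1)%N & N X <= 1]].

Definition dilation_factors (A : 'M[R]_(m, n)) : set R :=
  [set t | 0 < t /\ [set t *: X | X in convex_hull atoms_of] A].

(* The infimum is over a nonempty set bounded below: see
   [has_inf_dilation_factors]. *)
Definition dual_gauge (A : 'M[R]_(m, n)) : R := inf (dilation_factors A).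

End AtomicGauge.

Lemma convex_hull_comb (R : realType) (E : lmodType R) (S : set E)
    (x y : E) (a b : R) : 0 <= a -> 0 <= b -> a + b = 1 ->
  convex_hull S x -> convex_hull S y -> convex_hull S (a *: x + b *: y).
Proof.
move=> a0 b0 ab Sx Sy C /= [cC SC].
have a1 : a <= 1 by rewrite -ab lerDl.
have := cC x y (Itv01 a0 a1); rewrite !inE => /(_ (Sx C _) (Sy C _)).
rewrite /conv/= /mathcomp.classical.unstable.onem.
by have -> : 1 - a = b; [rewrite -ab addrC addKr|apply].
Qed.

Lemma has_inf_dilation_factors (R : realType) m n (N : 'M[R]_(m, n) -> R)
    (A : 'M[R]_(m, n)) :
  nonneg_valued N -> positively_homogeneous N -> A \is a mxOver Num.nneg ->
  has_inf (dilation_factors N A).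
Proof.
move=> N0 NZ /mxOverP A0; split; last by exists 0 => t /= [/ltW].
rewrite (matrix_sum_delta A).
have zero_nneg : (0 : 'M[R]_(m, n)) \is a mxOver Num.nneg.
  by apply/mxOverP => i j; rewrite mxE nnegrE.
have hull0 : convex_hull (atoms_of N) 0.
  apply: sub_gen_smallest; split; rewrite ?mxrank0//.
  by rewrite -(scale0r 0) NZ// mul0r.
have nn0 : dilation_factors N 0 !=set0.
  by exists 1; split => //; exists 0; rewrite ?scaler0.
have nnD B C : dilation_factors N B !=set0 -> dilation_factors N C !=set0 ->
    dilation_factors N (B + C) !=set0.
  move=> [s [s0 [X hX <-]]] [t [t0 [Y hY <-]]].
  have st0 : 0 < s + t by rewrite addr_gt0.
  exists (s + t); split => //.
  exists ((s / (s + t)) *: X + (t / (s + t)) *: Y).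
    apply: convex_hull_comb => //; rewrite ?divr_ge0// ?ltW//.
    by rewrite -mulrDl divff// gt_eqF.
  by rewrite scalerDr !scalerA !(mulrC (s + t)) !divfK// gt_eqF.
apply: (big_ind (fun B => dilation_factors N B !=set0)) => // i _.
apply: (big_ind (fun B => dilation_factors N B !=set0)) => // j _.
have Aij : 0 <= A i j by have := A0 i j; rewrite nnegrE.
set B := A i j *: _.
have B0 : B \is a mxOver Num.nneg.
  by apply/mxOverP => k l; rewrite !mxE nnegrE mulr_ge0 ?ler0n.
have t0 : 0 < 1 + N B by rewrite ltr_pwDl// N0.
exists (1 + N B); split => //; exists ((1 + N B)^-1 *: B); last first.
  by rewrite scalerA divff ?scale1r// gt_eqF.
apply: sub_gen_smallest; split.
- by apply/mxOverP => k l; rewrite !mxE nnegrE !mulr_ge0 ?invr_ge0 ?ler0n// ltW.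
- by rewrite !(leq_trans (mxrank_scale _ _))// mxrank_delta.
- by rewrite NZ ?invr_ge0 ?(ltW t0)// mulrC ler_pdivrMr// mul1r lerDr.
Qed.

Lemma tau_plus_max (R : realType) m n (A : 'M[R]_(m, n)) :
  A \is a mxOver Num.nneg ->
  tau_plus_values A (tau_plus A) /\ ubound (tau_plus_values A) (tau_plus A).
Proof.
move=> /mxOverP A0.
have {}A0 i j : 0 <= A i j by have := A0 i j; rewrite nnegrE.
pose P (v : 'rV[R]_(m * n)) (X : 'M[R]_(m, n)) := \tr ((vec_mx v)^T *m X).
have PE v X : P v X = \sum_i \sum_j v 0 (mxvec_index i j) * X i j.
  rewrite /P /mxtrace exchange_big; apply: eq_bigr => j _.
  by rewrite mxE; apply: eq_bigr => i _; rewrite !mxE.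
have sum_cont k (f : 'I_k -> 'rV[R]_(m * n) -> R) :
    (forall i, continuous (f i)) -> continuous (fun v => \sum_i f i v).
  move=> fc v; elim: (index_enum _) => [|i r IHr].
    rewrite (_ : (fun _ => _) = cst 0); first exact: cst_continuous.
    by apply/funext => w; rewrite big_nil.
  rewrite (_ : (fun _ => _) = (fun w => f i w + \sum_(i <- r) f i w)).
    by apply: continuousD; [exact: fc|exact: IHr].
  by apply/funext => w; rewrite big_cons.
have Pc X : continuous (P^~ X).
  rewrite (_ : P^~ X = fun v : 'rV_(m * n) =>
      \sum_i \sum_j v 0 (mxvec_index i j) * X i j); last by apply/funext => v.
  apply: (@sum_cont m) => i; apply: (@sum_cont n) => j v.
  by apply: cvgMr_tmp; [exact: (nbhs_filter v)|exact: coord_continuous].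
pose C : R := (m * n)%:R + 1.
pose b k := C * (mxvec A 0 k)^-1.
pose box := [set v : 'rV[R]_(m * n) | forall k, `[- b k, b k]%classic (v 0 k)].
pose F := \bigcap_(X in atoms_plus A) [set v | P v X <= 1].
have cbox : compact box.
  have := @rV_compact R (m * n) (fun k => `[- b k, b k]%classic); apply=> k.
  exact: segment_compact.
have cK : compact (box `&` F).
  apply: (subclosed_compact _ cbox); last exact: subIsetl.
  apply: closedI.
    exact: (compact_closed (@norm_hausdorff _ 'rV[R]_(m * n)) cbox).
  apply: closed_bigI => X _.
  apply: (@preimage_closed _ _ (P^~ X) [set x | x <= 1]).
    by move=> v _; exact: Pc.
  exact: closed_le.
have C0 : 0 <= C by rewrite addr_ge0.
have b0 k : 0 <= b k.
  by case/mxvec_indexP: k => i j; rewrite mulr_ge0// invr_ge0 mxvecE.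
have P0 X : P 0 X = 0 by rewrite PE big1// => i _; rewrite big1// => j _; rewrite mxE mul0r.
have K0 : (box `&` F) 0.
  by split => [k|X _]; rewrite /= ?P0 ?mxE ?in_itv/= ?oppr_le0 ?b0.
have [c] := @compact_EVT_max _ R (P^~ A) _ (ex_intro _ _ K0) cK
  (continuous_subspaceT (Pc A)).
rewrite inE => -[_ Fc] cmax.
have cA : tau_plus_values A (P c A).
  by exists (@mxtrace R n \o mulmx (vec_mx c)^T) => // X /Fc.
have c_ub : ubound (tau_plus_values A) (P c A).
  move=> _ [L LX <-].
  have [LA|/ltW LA] := leP 0 (L A); last first.
    by rewrite (le_trans LA)// -(P0 A); apply: cmax; rewrite inE.
  pose v := mxvec (\matrix_(i, j) (if A i j == 0 then 0 else L (delta_mx i j))).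
  have LE X : L X = \sum_i \sum_j X i j * L (delta_mx i j).
    rewrite {1}(matrix_sum_delta X) linear_sum; apply: eq_bigr => i _.
    by rewrite linear_sum; apply: eq_bigr => j _; rewrite linearZ.
  have PL X : le_mx 0 X -> le_mx X A -> P v X = L X.
    move=> X0 XA; rewrite PE LE; apply: eq_bigr => i _; apply: eq_bigr => j _.
    rewrite mxvecE mxE mulrC; case: eqP => // Aij.
    have -> : X i j = 0; last by rewrite !mul0r.
    by apply/eqP; rewrite eq_le -{1}Aij XA/=; have := X0 i j; rewrite mxE.
  have A0' : le_mx 0 A by move=> i j; rewrite mxE.
  rewrite -(PL A)//; apply: cmax; rewrite inE; split; last first.
    by move=> X AX; have [_ X0 XA] := AX; rewrite /= PL//; exact: LX.
  have lA i j : A i j * L (delta_mx i j) <= 1.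
    rewrite -linearZ/=; apply: LX; split.
    - by rewrite (leq_trans (mxrank_scale _ _))// mxrank_delta.
    - by move=> k l; rewrite !mxE mulr_ge0.
    - move=> k l; rewrite !mxE; case: eqP => [->|_]; last by rewrite mulr0.
      by case: eqP => [->|_]; rewrite ?mulr1 ?mulr0.
  have sumA : \sum_i \sum_j (1 - A i j * L (delta_mx i j)) <= (m * n)%:R.
    rewrite [leLHS](_ : _ = (m * n)%:R - L A); first by rewrite gerBl.
    under eq_bigr do rewrite sumrB.
    rewrite sumrB -LE; congr (_ - _).
    under eq_bigr do rewrite sumr_const card_ord.
    by rewrite sumr_const card_ord -mulrnA mulnC.
  have lB i j : - C <= A i j * L (delta_mx i j).
    have Cij : 1 - A i j * L (delta_mx i j) <= (m * n)%:R.
      apply: le_trans sumA; rewrite (bigD1 i)//= (bigD1 j)//= -addrA lerDl.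
      rewrite addr_ge0// sumr_ge0// => *; rewrite ?sumr_ge0// => *;
      by rewrite subr_ge0.
    rewrite lerNl /C (le_trans _ (lerD Cij (lexx 1)))// addrAC.
    by rewrite -[leLHS]add0r lerD.
  move=> k; case/mxvec_indexP: k => i j.
  rewrite /= in_itv/= /b !mxvecE mxE; case: eqVneq => [->|Aij].
    by rewrite invr0 mulr0 oppr0 lexx.
  have Aij0 : 0 < A i j by rewrite lt_def Aij A0.
  rewrite -mulNr ler_pdivrMr// ler_pdivlMr// ![L _ * _]mulrC lB/=.
  by rewrite (le_trans (lA i j))// lerDr.
have -> : tau_plus A = P c A; last by split.
apply/eqP; rewrite eq_le; apply/andP; split.
  by apply: ge_sup => //; exists (P c A).
by apply: ub_le_sup => //; exists (P c A).
Qed.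

(* Main.v *)
From HB Require Import structures.
Require Import Defs.
From mathcomp Require Import all_boot all_order all_algebra.
From mathcomp Require Import all_classical all_reals all_analysis.
Import Order.TTheory GRing.Theory Num.Theory.
Local Open Scope ring_scope.

Set Implicit Arguments.
Unset Strict Implicit.
Unset Printing Implicit Defensive.

(** The bound by the nonnegative rank holds because the terms of a nonnegative
    factorization of [A] are atoms of [A].  For the other bound, [N^*] is
    sublinear on the cone of nonnegative matrices, and after projecting onto the
    support of [A] the matrix [A] becomes an order unit of this cone.
    Hahn-Banach then gives a functional [L <= N^*] with [L A = N^* A]; since
    [N^* X <= N X <= N A] for all atoms [X] of [A], the functional [L / N A] is
    feasible for [tau_+].

    In finite dimension Hahn-Banach needs no transfinite induction: replacing [p]
    by [inf_(s >= 0) p (x + s e) - s p e] keeps it sublinear and makes it odd at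
    [e], and a sublinear function that is odd on a basis is linear. *)

(** * Hahn-Banach in finite dimension, for sublinear functions on a convex cone *)

Section HahnBanach.
Local Open Scope classical_set_scope.
Context {R : realType}.

Definition convex_cone {E : lmodType R} (D : set E) : Prop :=
  (forall x y, D x -> D y -> D (x + y)) /\
  (forall c x, 0 <= c -> D x -> D (c *: x)).

Definition sublinear_on {E : lmodType R} (D : set E) (p : E -> R) : Prop :=
  (forall x y, D x -> D y -> p (x + y) <= p x + p y) /\
  (forall c x, 0 <= c -> D x -> p (c *: x) <= c * p x).

(** The reverse inequality comes from scaling back by [c^-1]; at [c = 0], subadditivity gives
    [p 0 >= 0]. *)
Lemma sublinear_onZ (E : lmodType R) (D : set E) (p : E -> R) c x :
  convex_cone D -> sublinear_on D p -> 0 <= c -> D x -> p (c *: x) = c * p x.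
Proof.
move=> [_ DZ] [pD pZ] c0 Dx; apply/eqP; rewrite eq_le pZ//=.
have [->|cn0] := eqVneq c 0.
  have D0 : D 0 by rewrite -(scale0r x); exact: DZ.
  by rewrite mul0r scale0r; have := pD _ _ D0 D0; rewrite addr0 lerDl.
have cp : 0 < c by rewrite lt_def cn0.
have := pZ c^-1 (c *: x); rewrite scalerA mulVf// scale1r invr_ge0.
by move=> /(_ c0 (DZ _ _ c0 Dx)); rewrite ler_pdivlMl.
Qed.

Lemma sublinear0 (E : lmodType R) (p : E -> R) : sublinear_on setT p -> p 0 = 0.
Proof.
by move=> sp; rewrite -(scale0r 0) (@sublinear_onZ _ setT)// mul0r.
Qed.

(** Every [x] enters [D] after adding a multiple of [e], so the infimum of
    [g (x + s *: e) - s * g e] makes sense on all of [E]. It leaves the cone and makes [p] odd at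
    [e] in one step; [s = 0] gives [p <= g] on [D]. *)
Lemma sublinear_extension (E : lmodType R) (D : set E) (g : E -> R) (e : E) :
  convex_cone D -> sublinear_on D g -> D e ->
  (forall x, exists2 s, 0 <= s & D (x + s *: e)) ->
  exists p : E -> R, [/\ sublinear_on setT p,
    forall x, D x -> p x <= g x & p (- e) = - g e].
Proof.
move=> cD sg De De_unit; have [DD DZ] := cD; have [gD gZ] := sg.
pose V x := [set g (x + s *: e) - s * g e | s in
  [set s | 0 <= s /\ D (x + s *: e)]].
have V0 x : V x !=set0.
  by have [s s0 Ds] := De_unit x; exists (g (x + s *: e) - s * g e); exists s.
(* If [- x + r *: e] lies in [D], the sum of this point and [x + s *: e] is [(r + s) *: e], so
   subadditivity gives a lower bound independent of [s]. *)
have lbV x : has_lbound (V x).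
  have [r r0 Dr] := De_unit (- x).
  exists (r * g e - g (- x + r *: e)) => _ [s [s0 Ds] <-].
  rewrite lerBrDr addrAC lerBlDr -mulrDl [r + s]addrC.
  rewrite -(@sublinear_onZ _ D)// ?addr_ge0//.
  rewrite (_ : _ *: e = (x + s *: e) + (- x + r *: e)) ?gD//.
  by rewrite addrACA subrr add0r scalerDl.
pose p x := inf (V x).
have pV x v : V x v -> p x <= v by move=> xv; exact: ge_inf.
have leV x y : (forall v, V x v -> y <= v) -> y <= p x.
  by move=> h; apply: lb_le_inf.
have D0 : D 0 by rewrite -(scale0r e); exact: DZ.
have g0 : g 0 = 0 by rewrite -(scale0r e) (@sublinear_onZ _ D)// mul0r.
have sp : sublinear_on setT p.
  split=> [x y _ _|c x c0 _].
    rewrite -lerBlDr; apply: (leV) => _ [s [s0 Ds] <-].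
    rewrite lerBlDr -lerBlDl; apply: (leV) => _ [t [t0 Dt] <-].
    rewrite lerBlDl; apply: le_trans (pV _ (g (x + y + (s + t) *: e) -
      (s + t) * g e) _) _; last first.
      rewrite scalerDl addrACA mulrDl opprD [leRHS]addrACA lerD2r.
      exact: gD.
    exists (s + t) => //; split; first exact: addr_ge0.
    by rewrite scalerDl addrACA; exact: DD.
  have [->|cn0] := eqVneq c 0.
    rewrite scale0r mul0r; apply: (pV); exists 0; rewrite /= scale0r addr0//.
    by rewrite g0 mul0r subrr.
  have cp : 0 < c by rewrite lt_def cn0.
  rewrite -ler_pdivrMl//; apply: (leV) => _ [s [s0 Ds] <-].
  rewrite ler_pdivrMl//; apply: (pV); exists (c * s).
    split; first exact: mulr_ge0.
    by rewrite -scalerA -scalerDr; exact: DZ.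
  by rewrite -scalerA -scalerDr (@sublinear_onZ _ D)// mulrBr mulrA.
exists p; split=> // [x Dx|].
  by apply: (pV); exists 0; rewrite /= scale0r addr0// mul0r subr0.
apply/eqP; rewrite eq_le; apply/andP; split.
  by apply: (pV); exists 1; rewrite /= scale1r addNr// g0 mul1r sub0r.
(* Subadditivity is applied to [s *: e = (- e + s *: e) + e]. *)
apply: (leV) => _ [s [s0 Ds] <-].
rewrite lerBrDr addrC lerBlDr -(@sublinear_onZ _ D)//.
by have := gD _ _ Ds De; rewrite addrAC addNr add0r.
Qed.

(** Oddness gained at [e] survives later steps: if [q <= p'] then
    [q (- e) <= p' (- e) = - p e <= - q e], and the reverse inequality holds for every sublinear
    [q]. *)
Lemma sublinear_minorant (E : lmodType R) (p : E -> R) (s : seq E) :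
  sublinear_on setT p -> exists q : E -> R, [/\ sublinear_on setT q,
    forall x, q x <= p x & forall x, x \in s -> q (- x) = - q x].
Proof.
elim: s p => [|e s IHs] p sp; first by exists p.
have cT : convex_cone [set: E] by [].
have unitT x : exists2 s : R, 0 <= s & [set: E] (x + s *: e) by exists 0.
have [p' [sp' p'p p'e]] := sublinear_extension cT sp (I : setT e) unitT.
have [q [sq qp' qs]] := IHs _ sp'; exists q; split=> // [x|x].
  by rewrite (le_trans (qp' x))// p'p.
rewrite inE => /predU1P[->|]; last exact: qs.
apply/eqP; rewrite eq_le; apply/andP; split.
  rewrite (le_trans (qp' _))// p'e lerN2.
  by rewrite (le_trans (qp' _))// p'p.
have := sq.1 e (- e) I I; rewrite subrr (sublinear0 sq).
by rewrite -lerBlDl sub0r.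
Qed.

Lemma hahn_banach_vectType (E : vectType R) (p : E -> R) :
  sublinear_on setT p -> exists L : {scalar E}, forall x, L x <= p x.
Proof.
move=> sp; have [q [sq qp qb]] := sublinear_minorant (vbasis {:E}) sp.
have [qD qZ] := sq.
have q_ge x : - q (- x) <= q x.
  have := qD x (- x) I I; rewrite subrr (sublinear0 sq)//.
  by rewrite -lerBlDr sub0r.
have qN x : q (- x) = - q x.
  (* This inequality is stable under sums and under scalars of either sign, so it spreads from the
     basis to all of [E]. *)
  suff qNle : q (- x) <= - q x.
    by apply/eqP; rewrite eq_le qNle /=; have := q_ge (- x); rewrite opprK.
  rewrite (coord_vbasis (memvf x)).
  apply: (big_ind (fun y => q (- y) <= - q y)).
  - by rewrite oppr0 (sublinear0 sq)// oppr0.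
  - move=> y z qy qz; rewrite opprD (le_trans (qD _ _ I I))//.
    by rewrite (le_trans (lerD qy qz))// -opprD lerN2 qD.
  - move=> i _; set c := coord _ _ _; set b := _`_i.
    have bq : q (- b) = - q b by apply: qb; rewrite mem_nth// size_tuple.
    have [c0|/ltW c0] := leP 0 c.
      rewrite -scalerN (le_trans (qZ _ _ c0 I))// bq mulrN lerN2.
      exact: qZ.
    have Nc0 : 0 <= - c by rewrite oppr_ge0.
    rewrite -scaleNr (le_trans (qZ _ _ Nc0 I))// mulNr lerN2.
    have := qZ _ (- b) Nc0 I; rewrite scaleNr scalerN opprK bq mulNr mulrN.
    by rewrite opprK.
have lq : scalar q.
  move=> c x y.
  (* By oddness, subadditivity at [- u] and [- v] is superadditivity at [u] and [v]. *)
  have qDe u v : q (u + v) = q u + q v.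
    apply/eqP; rewrite eq_le qD//= -lerN2 -qN opprD opprD -!qN.
    exact: qD.
  rewrite qDe; congr (_ + _).
  have cT : convex_cone [set: E] by [].
  have [c0|/ltW c0] := leP 0 c; first exact: (@sublinear_onZ _ setT).
  rewrite -[c in LHS]opprK scaleNr qN (@sublinear_onZ _ setT)// ?oppr_ge0//.
  by rewrite mulNr opprK.
pose L : {scalar E} := HB.pack q (GRing.isLinear.Build _ _ _ _ q lq).
by exists L.
Qed.

End HahnBanach.

(** Equality at [e] comes from the bound at [- e]: [L (- e) <= p (- e) = - g e]. *)
Lemma hahn_banach_order_unit (R : realType) (E : vectType R) (D : set E)
    (g : E -> R) (e : E) :
  convex_cone D -> sublinear_on D g -> D e ->
  (forall x, exists2 s, 0 <= s & D (x + s *: e)) ->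
  exists L : {scalar E}, (forall x, D x -> L x <= g x) /\ L e = g e.
Proof.
move=> cD sg De De_unit.
have [p [sp pg pe]] := sublinear_extension cD sg De De_unit.
have [L Lp] := hahn_banach_vectType sp.
exists L; split=> [x Dx|]; first by rewrite (le_trans (Lp x))// pg.
apply/eqP; rewrite eq_le (le_trans (Lp e)) ?pg//=.
by rewrite -lerN2 -pe -linearN.
Qed.

(** * The gauge [dual_gauge N] on the cone of nonnegative matrices *)

Section AtomicGaugeTheory.
Local Open Scope classical_set_scope.
Context {R : realType} {m n : nat} (N : 'M[R]_(m, n) -> R).
Hypotheses (N_ge0 : nonneg_valued N) (N_hom : positively_homogeneous N).
Implicit Types A X Y : 'M[R]_(m, n).

Lemma mxOver_nneg_cone :
  convex_cone [set A : 'M[R]_(m, n) | A \is a mxOver Num.nneg].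
Proof.
split=> [A B /mxOverP A0 /mxOverP B0|c A c0 /mxOverP A0];
  apply/mxOverP => i j; rewrite !mxE nnegrE.
- by rewrite addr_ge0// -nnegrE.
- by rewrite mulr_ge0// -nnegrE.
Qed.

Lemma dual_gauge_le A t : dilation_factors N A t -> dual_gauge N A <= t.
Proof. by apply: ge_inf; exists 0 => s /= [/ltW]. Qed.

Lemma le_dual_gauge A y : A \is a mxOver Num.nneg ->
  (forall t, dilation_factors N A t -> y <= t) -> y <= dual_gauge N A.
Proof.
move=> A0; apply: lb_le_inf.
by have [] := has_inf_dilation_factors N_ge0 N_hom A0.
Qed.

Lemma dilation_factorsD A B s t :
  dilation_factors N A s -> dilation_factors N B t ->
  dilation_factors N (A + B) (s + t).
Proof.
move=> [s0 [X hX <-]] [t0 [Y hY <-]].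
have st0 : 0 < s + t by rewrite addr_gt0.
split=> //; exists ((s / (s + t)) *: X + (t / (s + t)) *: Y).
  apply: convex_hull_comb => //; rewrite ?divr_ge0// ?ltW//.
  by rewrite -mulrDl divff// gt_eqF.
by rewrite scalerDr !scalerA !(mulrC (s + t)) !divfK// gt_eqF.
Qed.

Lemma dilation_factorsZ A c t :
  0 < c -> dilation_factors N A t -> dilation_factors N (c *: A) (c * t).
Proof.
move=> c0 [t0 [X hX <-]]; split; first exact: mulr_gt0.
by exists X; rewrite ?scalerA.
Qed.

(** The matrix [t^-1 *: X] is itself in [atoms_of N]. The slack between [N X] and [t] permits
    [t = N A] for atoms of [A], and any [t > 0] when [N X = 0]. *)
Lemma dilation_factors_rank1 X t :
  X \is a mxOver Num.nneg -> (\rank X <= 1)%N -> N X <= t -> 0 < t ->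
  dilation_factors N X t.
Proof.
move=> X0 rX NX t0; split=> //; exists (t^-1 *: X); last first.
  by rewrite scalerA divff ?scale1r// gt_eqF.
apply: sub_gen_smallest; split.
- by apply: mxOver_nneg_cone.2 => //; rewrite invr_ge0 ltW.
- by rewrite (leq_trans (mxrank_scale _ _)).
- by rewrite N_hom// ?invr_ge0 ?(ltW t0)// ler_pdivrMl// mulr1.
Qed.

Lemma sublinear_dual_gauge :
  sublinear_on [set A | A \is a mxOver Num.nneg] (dual_gauge N).
Proof.
split=> [A B A0 B0|c A c0 A0].
  rewrite -lerBlDr; apply: le_dual_gauge => // s As.
  rewrite lerBlDr -lerBlDl; apply: le_dual_gauge => // t Bt.
  by rewrite lerBlDl; apply: dual_gauge_le; exact: dilation_factorsD.
have [->|cn0] := eqVneq c 0.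
  (* Dilation factors are strictly positive, so the value 0 is approached rather than attained:
     every [t > 0] is a factor of the zero matrix. *)
  rewrite mul0r; apply/ler_addgt0Pl => t t0; rewrite addr0.
  apply: dual_gauge_le; apply: dilation_factors_rank1 => //.
  - by apply: mxOver_nneg_cone.2.
  - by rewrite scale0r mxrank0.
  - by rewrite N_hom// mul0r ltW.
have cp : 0 < c by rewrite lt_def cn0.
rewrite -ler_pdivrMl//; apply: le_dual_gauge => // t At.
by rewrite ler_pdivrMl//; apply: dual_gauge_le; exact: dilation_factorsZ.
Qed.

End AtomicGaugeTheory.

(** * Projection onto the support of [A] *)

Definition support_proj (R : realType) (m n : nat) (A X : 'M[R]_(m, n)) :
    'M[R]_(m, n) :=
  \matrix_(i, j) if A i j == 0 then 0 else X i j.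

Lemma support_projD (R : realType) (m n : nat) (A X Y : 'M[R]_(m, n)) :
  support_proj A (X + Y) = support_proj A X + support_proj A Y.
Proof. by apply/matrixP => i j; rewrite !mxE; case: ifP; rewrite ?addr0. Qed.

Lemma support_projZ (R : realType) (m n : nat) (A X : 'M[R]_(m, n)) c :
  support_proj A (c *: X) = c *: support_proj A X.
Proof. by apply/matrixP => i j; rewrite !mxE; case: ifP; rewrite ?mulr0. Qed.

Lemma support_proj_id (R : realType) (m n : nat) (A X : 'M[R]_(m, n)) :
  le_mx 0 X -> le_mx X A -> support_proj A X = X.
Proof.
move=> X0 XA; apply/matrixP => i j; rewrite mxE; case: eqP => // Aij.
by apply/eqP; rewrite eq_le -{2}Aij XA andbT; have := X0 i j; rewrite mxE.
Qed.

Lemma support_proj_order_unit (R : realType) (m n : nat) (A X : 'M[R]_(m, n)) :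
  A \is a mxOver Num.nneg ->
  exists2 s, 0 <= s & support_proj A (X + s *: A) \is a mxOver Num.nneg.
Proof.
move=> /mxOverP A0.
have {}A0 i j : 0 <= A i j by have := A0 i j; rewrite nnegrE.
have q0 i j : 0 <= `|X i j| / A i j by rewrite divr_ge0.
(* The sum dominates each of its nonnegative terms; where [A i j = 0] the quotient is 0 by
   convention and the projection erases the entry. *)
exists (\sum_i \sum_j `|X i j| / A i j).
  by apply: sumr_ge0 => i _; apply: sumr_ge0.
apply/mxOverP => i j; rewrite !mxE nnegrE; case: eqVneq => // Aij.
have Ap : 0 < A i j by rewrite lt_def Aij A0.
rewrite -lerBlDl sub0r (le_trans (ler_norm _))// normrN -ler_pdivrMr//.
rewrite (bigD1 i)//= (bigD1 j)//= -addrA lerDl addr_ge0// sumr_ge0// => k _.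
exact: sumr_ge0.
Qed.

(** * The upper and lower bounds for [tau_plus A] *)

Lemma tau_plus_le_factorization (R : realType) (m n : nat) (A : 'M[R]_(m, n))
    r :
  nonneg_factorization A r -> tau_plus A <= r%:R.
Proof.
move=> [u [v [u0 v0 AE]]].
have uv0 k i j : 0 <= (u k *m (v k)^T) i j.
  rewrite mxE sumr_ge0// => l _; rewrite mxE mulr_ge0// -nnegrE.
    exact: (mxOverP (u0 k)).
  exact: (mxOverP (v0 k)).
have A0 : A \is a mxOver Num.nneg.
  by apply/mxOverP => i j; rewrite nnegrE AE summxE sumr_ge0.
apply: ge_sup; first by exists (tau_plus A); have [] := tau_plus_max A0.
move=> _ [L Latoms <-]; rewrite AE linear_sum -[r in leRHS]card_ord -sumr_const.
(* Each of the [r] terms contributes at most 1; it lies below [A] because the other terms are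
   nonnegative. *)
apply: ler_sum => k _; apply: Latoms; split.
- by rewrite (leq_trans (mxrankM_maxl _ _))// rank_leq_col.
- by move=> i j; rewrite mxE.
- by move=> i j; rewrite AE summxE (bigD1 k)//= lerDl sumr_ge0.
Qed.

Unset Implicit Arguments.

Theorem theorem5 (R : realType) (m n : nat) (N : 'M[R]_(m, n) -> R)
    (N_ge0 : nonneg_valued N) (N_mono : monotone_mx N)
    (N_hom : positively_homogeneous N)
    (A : 'M[R]_(m, n)) (A_ge0 : A \is a mxOver Num.nneg) (NA_gt0 : 0 < N A) :
  (nonneg_rank A_ge0)%:R >= tau_plus A /\
  tau_plus A >= dual_gauge N A / N A.
Proof.
split.
  rewrite /nonneg_rank; case: ex_minnP => r /asboolP Ar _.
  exact: tau_plus_le_factorization.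
have A0 : le_mx 0 A.
  by move=> i j; rewrite mxE; have := mxOverP A_ge0 i j; rewrite nnegrE.
pose pi := support_proj A.
have piA : pi A = A by apply: support_proj_id.
(* Entries off the support of [A] are unconstrained in [D], so [A] is an order unit for [D] even
   when it has zero entries. *)
pose D : set 'M[R]_(m, n) := [set X | pi X \is a mxOver Num.nneg]%classic.
have [nnD nnZ] := @mxOver_nneg_cone R m n.
have [gD gZ] := sublinear_dual_gauge N_ge0 N_hom.
have cD : convex_cone D.
  split=> [X Y DX DY|c X c0 DX];
    rewrite /D /= /pi ?support_projD ?support_projZ.
    exact: nnD.
  exact: nnZ.
have sg : sublinear_on D (dual_gauge N \o pi).
  split=> [X Y DX DY|c X c0 DX]; rewrite /= /pi ?support_projD ?support_projZ.
    exact: gD.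
  exact: gZ.
have DA : D A by rewrite /D /= piA.
have [L [Lg LA]] := hahn_banach_order_unit cD sg DA
  (fun X => support_proj_order_unit X A_ge0).
(* It suffices to exhibit one feasible functional with this value at [A]. Since [pi] fixes [A] and
   its atoms, the bound on [L] there is by [dual_gauge N] itself. *)
apply: (tau_plus_max A_ge0).2; exists ((N A)^-1 \*: L)%R.
  move=> X [rX X0 XA].
  have X_ge0 : X \is a mxOver Num.nneg.
    by apply/mxOverP => i j; have := X0 i j; rewrite mxE nnegrE.
  have piX : pi X = X by apply: support_proj_id.
  rewrite /= ler_pdivrMl// mulr1 (le_trans (Lg X _))//= /D /= piX//.
  apply: dual_gauge_le; apply: dilation_factors_rank1 => //.
  exact: N_mono.
by rewrite /= LA /= piA mulrC.
Qed.
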